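(* If $R$ is a purely infinite simple ring, then $K_1(R)=U(R)^{\mathrm{ab}}$; that is, the canonical homomorphism $U(R)\to K_1(R)$ induces an isomorphism from the abelianization $U(R)^{\mathrm{ab}}=U(R)/U(R)'$ onto $K_1(R)$.
   Context: All rings are unital. An idempotent $e$ in a ring $R$ is infinite if there exist orthogonal idempotents $f,g\in R$ with $e=f+g$, $g\neq 0$ and $eR\cong fR$ as right $R$-modules. A simple ring $R$ is purely infinite if every nonzero right ideal of $R$ contains an infinite idempotent. $U(R)$ is the group of units of $R$, $U(R)'$ its commutator subgroup, and $K_1(R)=GL(R)^{\mathrm{ab}}$ is the algebraic $K_1$ group, with canonical map $U(R)=GL_1(R)\to GL(R)\to K_1(R)$. *)

(* Defs.v *)
From HB Require Import structures.
From mathcomp Require Import all_boot all_order all_algebra.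
From mathcomp Require Import boolp.

Set Implicit Arguments.
Unset Strict Implicit.
Unset Printing Implicit Defensive.

Import GRing.Theory.
Local Open Scope ring_scope.
Local Open Scope quotient_scope.

(** Subsets are boolean predicates; since [boolp] provides [`[< P >]] for every
    [P : Prop], quantifying over [{pred T}] is quantifying over all subsets. *)

Section Ideals.
Variable R : nzRingType.
Implicit Types (I : {pred R}) (e f : R).

Definition right_ideal I : Prop :=
  zmod_closed I /\ (forall x r, x \in I -> x * r \in I).

Definition two_sided_ideal I : Prop :=
  zmod_closed I /\ (forall x r, x \in I -> r * x \in I /\ x * r \in I).

Definition simple_ring : Prop :=
  forall I, two_sided_ideal I ->
    (forall x, x \in I -> x = 0) \/ (forall x, x \in I).

(** A right [R]-module is an [lmodType] over the converse ring [R^c]; the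
    regular right module is [R^c^o], in which [a *: x] is the product [x * a]
    of [R].  [rprincipal e] is the submodule [eR]. *)
Definition rprincipal_pred e : {pred R^c^o} :=
  fun x : R => `[< exists r : R, x = e * r >].

Fact rprincipal_submod_closed e : submod_closed (rprincipal_pred e).
Proof.
split=> [|a u v /asboolP[r ur] /asboolP[s vs]]; apply/asboolP.
  by exists 0; rewrite mulr0.
exists (r * (a : R) + s).
have -> : a *: u + v = (u : R) * (a : R) + (v : R) by [].
by rewrite ur vs mulrDr mulrA.
Qed.

HB.instance Definition _ e :=
  GRing.isSubmodClosed.Build R^c R^c^o (rprincipal_pred e)
    (rprincipal_submod_closed e).

Record rprincipal e := RPrincipal {
  rprincipal_val :> R^c^o;
  _ : rprincipal_val \in rprincipal_pred e
}.

HB.instance Definition _ e := [isSub for @rprincipal_val e].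
HB.instance Definition _ e := [Choice of rprincipal e by <:].
HB.instance Definition _ e :=
  [SubChoice_isSubLmodule of rprincipal e by <:].

Definition right_module_iso (V W : lmodType R^c) : Prop :=
  exists phi : {linear V -> W}, bijective phi.

Definition idempotent_elt e : Prop := e * e = e.

Definition infinite_idempotent e : Prop :=
  idempotent_elt e /\
  exists f g : R,
    [/\ idempotent_elt f /\ idempotent_elt g, f * g = 0 /\ g * f = 0,
        e = f + g, g <> 0
      & right_module_iso (rprincipal e) (rprincipal f)].

Definition purely_infinite_simple : Prop :=
  simple_ring /\
  forall I, right_ideal I -> (exists2 x, x \in I & x <> 0) ->
    exists2 e, e \in I & infinite_idempotent e.

End Ideals.

Section Units.
Variable S : pzRingType.

(** A unit is recorded together with its (unique) two-sided inverse. *)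
Definition is_unit_pair : pred (S * S) :=
  fun x => (x.1 * x.2 == 1) && (x.2 * x.1 == 1).

Record units := Units { units_pair : S * S; _ : is_unit_pair units_pair }.

HB.instance Definition _ := [isSub for units_pair].
HB.instance Definition _ := [Choice of units by <:].

Definition uval (u : units) : S := (units_pair u).1.
Definition uinv (u : units) : S := (units_pair u).2.

Lemma uvalV u : uval u * uinv u = 1.
Proof. by case/andP: (valP u) => /eqP. Qed.

Lemma uinvV u : uinv u * uval u = 1.
Proof. by case/andP: (valP u) => _ /eqP. Qed.

Definition mk_units a b (ab : a * b = 1) (ba : b * a = 1) : units :=
  @Units (a, b) (introT andP (conj (introT eqP ab) (introT eqP ba))).

Lemma uval_inj : injective uval.
Proof.
move=> u v uv; apply: val_inj.
have : uinv u = uinv v.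
  by rewrite -[uinv u]mulr1 -(uvalV v) -uv mulrA uinvV mul1r.
by move: uv; case: u v => -[a b] ? [[c d] ?]; rewrite /uval /uinv /= => -> ->.
Qed.

Fact units_mul1 (u v : units) : uval u * uval v * (uinv v * uinv u) = 1.
Proof. by rewrite mulrA -[_ * uinv v]mulrA uvalV mulr1 uvalV. Qed.

Fact units_mul2 (u v : units) : uinv v * uinv u * (uval u * uval v) = 1.
Proof. by rewrite mulrA -[_ * uval u]mulrA uinvV mulr1 uinvV. Qed.

Definition units_one : units := mk_units (mulr1 1) (mulr1 1).
Definition units_mul (u v : units) : units :=
  mk_units (units_mul1 u v) (units_mul2 u v).
Definition units_inv (u : units) : units := mk_units (uinvV u) (uvalV u).

Fact units_mulA : associative units_mul.
Proof. by move=> u v w; apply: uval_inj; rewrite /uval /= mulrA. Qed.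
Fact units_mul1u : left_id units_one units_mul.
Proof. by move=> u; apply: uval_inj; rewrite /uval /= mul1r. Qed.
Fact units_mulu1 : right_id units_one units_mul.
Proof. by move=> u; apply: uval_inj; rewrite /uval /= mulr1. Qed.
Fact units_mulVu : left_inverse units_one units_inv units_mul.
Proof. by move=> u; apply: uval_inj; apply: uinvV. Qed.
Fact units_muluV : right_inverse units_one units_inv units_mul.
Proof. by move=> u; apply: uval_inj; apply: uvalV. Qed.

HB.instance Definition _ := isGroup.Build units
  units_mulA units_mul1u units_mulu1 units_mulVu units_muluV.

Lemma uvalM (u v : units) : uval (u * v)%g = uval u * uval v.
Proof. by []. Qed.

Lemma uval1 : uval 1%g = 1.
Proof. by []. Qed.

End Units.

Section Abelianization.
Local Open Scope group_scope.
Variable G : groupType.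
Implicit Types x y z : G.

Definition commutator_subgroup : {pred G} := fun x =>
  `[< forall H : {pred G}, group_closed H ->
        (forall a b : G, [~ a, b] \in H) -> x \in H >].

Lemma commutator_subgroup_commg x y : [~ x, y] \in commutator_subgroup.
Proof. by apply/asboolP => H _; apply. Qed.

Lemma commutator_subgroup_closed : group_closed commutator_subgroup.
Proof.
split=> [|x y /asboolP Hx /asboolP Hy]; apply/asboolP => H cH comH.
  by case: cH.
by case: (cH) => _; apply; [exact: Hx|exact: Hy].
Qed.

Let D1 : 1 \in commutator_subgroup.
Proof. by case: commutator_subgroup_closed. Qed.
Let DV x : x \in commutator_subgroup -> x^-1 \in commutator_subgroup.
Proof.
by move=> Dx; rewrite -[x^-1]mul1g; case: commutator_subgroup_closed => _; apply.
Qed.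
Let DM x y : x \in commutator_subgroup -> y \in commutator_subgroup ->
  x * y \in commutator_subgroup.
Proof.
move=> Dx Dy; rewrite -[y]invgK; case: commutator_subgroup_closed => _ DF.
by apply: DF => //; apply: DV.
Qed.
Let DJ x y : x \in commutator_subgroup -> x ^ y \in commutator_subgroup.
Proof.
move=> Dx; have -> : x ^ y = x * [~ x, y] by rewrite /commg mulVKg.
by apply: DM => //; apply: commutator_subgroup_commg.
Qed.

Definition ab_rel : rel G := fun x y => x^-1 * y \in commutator_subgroup.

Fact ab_rel_equiv : equiv_class_of ab_rel.
Proof.
split=> [x | x y | y x z]; rewrite /ab_rel.
- by rewrite mulVg.
- by apply/idP/idP => /DV; rewrite invgM invgK.
- by move=> xy /(DM xy); rewrite mulgA mulgK.
Qed.

Canonical ab_equiv := EquivRelPack ab_rel_equiv.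

Definition abelianization := {eq_quot ab_rel}.
HB.instance Definition _ := Choice.on abelianization.
HB.instance Definition _ := EqQuotient.on abelianization.

Definition ab x : abelianization := \pi_abelianization x.

Lemma abP x y : reflect (ab x = ab y) (x^-1 * y \in commutator_subgroup).
Proof. by apply: (iffP idP) => [? | /eqP]; [apply/eqmodP | rewrite eqmodE]. Qed.

Lemma ab_surj (c : abelianization) : exists x, ab x = c.
Proof. by exists (repr c); rewrite /ab reprK. Qed.

Definition ab_mul (c d : abelianization) : abelianization :=
  ab (repr c * repr d).
Definition ab_inv (c : abelianization) : abelianization := ab (repr c)^-1.

Let ab_repr x : x^-1 * repr (ab x) \in commutator_subgroup.
Proof. by apply/abP; rewrite /ab reprK. Qed.

Let ab_mulE x y : ab_mul (ab x) (ab y) = ab (x * y).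
Proof.
apply/esym/abP; rewrite invgM -mulgA.
have -> : y^-1 * (x^-1 * (repr (ab x) * repr (ab y))) =
  (x^-1 * repr (ab x)) ^ y * (y^-1 * repr (ab y)).
  by rewrite /conjg !mulgA mulgK.
by apply: DM; [apply: DJ|]; apply: ab_repr.
Qed.

Let ab_invE x : ab_inv (ab x) = ab x^-1.
Proof.
apply/abP; rewrite invgK.
have -> : repr (ab x) / x = (x^-1 * repr (ab x)) ^ x^-1.
  by rewrite /conjg invgK !mulgA mulgV mul1g.
by apply: DJ; apply: ab_repr.
Qed.

Fact ab_mulA : associative ab_mul.
Proof.
move=> c d e; case: (ab_surj c) (ab_surj d) (ab_surj e) => x <- [y <-] [z <-].
by rewrite !ab_mulE mulgA.
Qed.
Fact ab_mul1g : left_id (ab 1) ab_mul.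
Proof. by move=> c; case: (ab_surj c) => x <-; rewrite ab_mulE mul1g. Qed.
Fact ab_mulg1 : right_id (ab 1) ab_mul.
Proof. by move=> c; case: (ab_surj c) => x <-; rewrite ab_mulE mulg1. Qed.
Fact ab_mulVg : left_inverse (ab 1) ab_inv ab_mul.
Proof.
by move=> c; case: (ab_surj c) => x <-; rewrite ab_invE ab_mulE mulVg.
Qed.
Fact ab_mulgV : right_inverse (ab 1) ab_inv ab_mul.
Proof.
by move=> c; case: (ab_surj c) => x <-; rewrite ab_invE ab_mulE mulgV.
Qed.

HB.instance Definition _ := isGroup.Build abelianization
  ab_mulA ab_mul1g ab_mulg1 ab_mulVg ab_mulgV.

Fact ab_is_morphism : {morph ab : x y / x * y}.
Proof. by move=> x y; rewrite -ab_mulE. Qed.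

HB.instance Definition _ := isMultiplicative.Build G abelianization ab
  ab_is_morphism.

End Abelianization.

Section StableGL.
Variable R : nzRingType.

(** Entry [(i, j)] of the infinite matrix [diag(A, 1, 1, ...)]. *)
Definition stab_entry n (A : 'M[R]_n) (i j : nat) : R :=
  match insub i, insub j with
  | Some i', Some j' => A i' j'
  | _, _ => (i == j)%:R
  end.

(** [diag(A, 1)], of size [N]; only used for [n <= N], see [stab_mx_block]. *)
Definition stab_mx N n (A : 'M[R]_n) : 'M[R]_N :=
  \matrix_(i, j) stab_entry A i j.

Lemma stab_entryE n (A : 'M[R]_n) (i j : 'I_n) : stab_entry A i j = A i j.
Proof. by rewrite /stab_entry !valK. Qed.

Lemma stab_mx_id n (A : 'M[R]_n) : stab_mx n A = A.
Proof. by apply/matrixP => i j; rewrite mxE stab_entryE. Qed.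

Lemma stab_mx_block n k (A : 'M[R]_n) :
  stab_mx (n + k) A = block_mx A 0 0 1%:M.
Proof.
apply/matrixP => i j; rewrite mxE /stab_entry.
rewrite -(splitK i) -(splitK j); case: (split i) (split j) => [i'|i'] [j'|j'] /=.
- by rewrite !valK block_mxEul.
- rewrite valK insubF ?ltnNge ?leq_addr // block_mxEur mxE.
  by rewrite ltn_eqF // (leq_trans (ltn_ord i')) ?leq_addr.
- rewrite insubF ?ltnNge ?leq_addr // block_mxEdl mxE.
  by rewrite gtn_eqF // (leq_trans (ltn_ord j')) ?leq_addr.
- by rewrite insubF ?ltnNge ?leq_addr // block_mxEdr mxE eqn_add2l.
Qed.

Lemma stab_entry_out n (A : 'M[R]_n) i j :
  (n <= i)%N || (n <= j)%N -> stab_entry A i j = (i == j)%:R.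
Proof.
case/orP=> ?; rewrite /stab_entry.
  by rewrite [insub i]insubF // ltnNge; apply/negbF.
by rewrite [insub j]insubF ?ltnNge; [case: insub | apply/negbF].
Qed.

Lemma stab_entry_stab N n (A : 'M[R]_n) i j : (n <= N)%N ->
  stab_entry (stab_mx N A) i j = stab_entry A i j.
Proof.
move=> nN; have [|iN] := leqP N i.
  by move=> Ni; rewrite !stab_entry_out ?Ni // (leq_trans nN Ni).
have [|jN] := leqP N j.
  by move=> Nj; rewrite !stab_entry_out ?Nj ?(leq_trans nN Nj) ?orbT.
by rewrite -[i]/(val (Ordinal iN)) -[j]/(val (Ordinal jN)) stab_entryE mxE.
Qed.

Lemma stab_mx_stab p N n (A : 'M[R]_n) : (n <= N)%N ->
  stab_mx p (stab_mx N A) = stab_mx p A.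
Proof. by move=> nN; apply/matrixP => i j; rewrite !mxE stab_entry_stab. Qed.

Lemma stab_mxM N n (A B : 'M[R]_n) : (n <= N)%N ->
  stab_mx N (A *m B) = stab_mx N A *m stab_mx N B.
Proof.
move=> nN; rewrite -(subnKC nN) !stab_mx_block mulmx_block.
by rewrite !mulmx0 !mul0mx !mulmx1 !addr0 add0r.
Qed.

Lemma stab_mx1 N n : (n <= N)%N -> stab_mx N (1%:M : 'M[R]_n) = 1%:M.
Proof. by move=> nN; rewrite -(subnKC nN) stab_mx_block -scalar_mx_block. Qed.

Definition GLn n := units 'M[R]_n.

Fact stab_units1 N n (nN : (n <= N)%N) (g : GLn n) :
  stab_mx N (uval g) * stab_mx N (uinv g) = 1 :> 'M[R]_N.
Proof.
rewrite -[LHS]stab_mxM //; have -> : uval g *m uinv g = 1%:M := uvalV g.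
exact: stab_mx1.
Qed.

Fact stab_units2 N n (nN : (n <= N)%N) (g : GLn n) :
  stab_mx N (uinv g) * stab_mx N (uval g) = 1 :> 'M[R]_N.
Proof.
rewrite -[LHS]stab_mxM //; have -> : uinv g *m uval g = 1%:M := uinvV g.
exact: stab_mx1.
Qed.

Definition stab_GLn N n (nN : (n <= N)%N) (g : GLn n) : GLn N :=
  mk_units (stab_units1 nN g) (stab_units2 nN g).

Lemma stab_GLnM N n (nN : (n <= N)%N) (g h : GLn n) :
  stab_GLn nN (g * h)%g = (stab_GLn nN g * stab_GLn nN h)%g.
Proof. by apply: uval_inj; apply: stab_mxM. Qed.

(** [GL(R)] is the direct limit of the groups [GL_n(R)] along
    [g |-> diag(g, 1)]: the quotient of their disjoint union identifying two
    matrices that become equal after stabilization to a common size. *)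
Definition GL_pre := {n : nat & GLn n}.

Definition GL_rel : rel GL_pre := fun x y =>
  stab_mx (maxn (tag x) (tag y)) (uval (tagged x))
  == stab_mx (maxn (tag x) (tag y)) (uval (tagged y)).

Lemma GL_relP (x y : GL_pre) :
  reflect (stab_entry (uval (tagged x)) =2 stab_entry (uval (tagged y)))
          (GL_rel x y).
Proof.
apply: (iffP eqP) => [xy i j | xy]; last by apply/matrixP => i j; rewrite !mxE.
rewrite -(stab_entry_stab _ i j (leq_maxl (tag x) (tag y))) xy.
by rewrite stab_entry_stab // leq_maxr.
Qed.

Fact GL_rel_equiv : equiv_class_of GL_rel.
Proof.
split=> [x | x y | y x z].
- exact/GL_relP.
- by apply/GL_relP/GL_relP => xy i j; rewrite xy.
- by move=> /GL_relP xy /GL_relP yz; apply/GL_relP => i j; rewrite xy yz.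
Qed.

Canonical GL_equiv := EquivRelPack GL_rel_equiv.

Definition GL := {eq_quot GL_rel}.
HB.instance Definition _ := Choice.on GL.
HB.instance Definition _ := EqQuotient.on GL.

Definition GL_of n (g : GLn n) : GL := \pi_GL (Tagged GLn g).

Definition GL_mul (x y : GL) : GL :=
  let n := tag (repr x) in let m := tag (repr y) in
  GL_of (stab_GLn (leq_maxl n m) (tagged (repr x)) *
         stab_GLn (leq_maxr n m) (tagged (repr y)))%g.

Definition GL_inv (x : GL) : GL := GL_of (tagged (repr x))^-1%g.

Definition GL_one : GL := GL_of (1%g : GLn 0).

Lemma GL_ofP n m (g : GLn n) (h : GLn m) :
  GL_of g = GL_of h <-> stab_entry (uval g) =2 stab_entry (uval h).
Proof.
split=> [/eqP|gh]; first by rewrite eqmodE => /GL_relP.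
by apply/eqmodP/GL_relP.
Qed.

Lemma GL_of_stab N n (nN : (n <= N)%N) (g : GLn n) :
  GL_of (stab_GLn nN g) = GL_of g.
Proof. by apply/GL_ofP => i j; apply: stab_entry_stab. Qed.

Lemma GL_of_inj n : injective (@GL_of n).
Proof.
move=> g h /GL_ofP gh; apply: uval_inj; apply/matrixP => i j.
by rewrite -!stab_entryE.
Qed.

Lemma GL_of_repr (x : GL) : GL_of (tagged (repr x)) = x.
Proof. by rewrite /GL_of taggedK reprK. Qed.

Lemma GL_of_large (x : GL) : exists n, forall N, (n <= N)%N ->
  exists g : GLn N, GL_of g = x.
Proof.
exists (tag (repr x)) => N nN.
by exists (stab_GLn nN (tagged (repr x))); rewrite GL_of_stab GL_of_repr.
Qed.

Let GL_mulE n (g h : GLn n) : GL_mul (GL_of g) (GL_of h) = GL_of (g * h)%g.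
Proof.
rewrite /GL_mul; set g' := tagged _; set h' := tagged (repr (GL_of h)).
have eg : GL_of g' = GL_of g by rewrite GL_of_repr.
have eh : GL_of h' = GL_of h by rewrite GL_of_repr.
move: g' h' eg eh; set a := tag _; set b := tag _ => g' h' eg eh.
pose N := maxn n (maxn a b).
have nN : (n <= N)%N by apply: leq_maxl.
have abN : (maxn a b <= N)%N by apply: leq_maxr.
rewrite -(GL_of_stab nN) -(GL_of_stab abN) !stab_GLnM.
by congr (GL_of (_ * _)%g); apply: GL_of_inj; rewrite !GL_of_stab.
Qed.

Let GL_invE n (g : GLn n) : GL_inv (GL_of g) = GL_of g^-1%g.
Proof.
rewrite /GL_inv; set g' := tagged _.
have eg : GL_of g' = GL_of g by rewrite GL_of_repr.
move: g' eg; set a := tag _ => g' eg.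
have nN := leq_maxl n a; have aN := leq_maxr n a.
rewrite -(GL_of_stab nN) -(GL_of_stab aN); congr GL_of.
have E : stab_GLn aN g' = stab_GLn nN g by apply: GL_of_inj; rewrite !GL_of_stab.
have stabV m (mN : (m <= maxn n a)%N) (k : GLn m) :
  stab_GLn mN k^-1%g = ((stab_GLn mN k)^-1)%g by apply: uval_inj.
by rewrite !stabV E.
Qed.

Let GL_oneE n : GL_one = GL_of (1%g : GLn n).
Proof.
by rewrite /GL_one -(GL_of_stab (leq0n n)); congr GL_of; apply: uval_inj; apply: stab_mx1.
Qed.

Let GL_common (x y z : GL) : exists N (g h k : GLn N),
  [/\ GL_of g = x, GL_of h = y & GL_of k = z].
Proof.
have [[[a ga] [b gb]] [c gc]] :=
  (GL_of_large x, GL_of_large y, GL_of_large z).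
have [g <-] := ga _ (leq_trans (leq_maxl a b) (leq_maxl _ c)).
have [h <-] := gb _ (leq_trans (leq_maxr a b) (leq_maxl _ c)).
have [k <-] := gc _ (leq_maxr (maxn a b) c).
by exists (maxn (maxn a b) c), g, h, k.
Qed.

Fact GL_mulA : associative GL_mul.
Proof.
move=> x y z; have [N [g [h [k [<- <- <-]]]]] := GL_common x y z.
by rewrite !GL_mulE mulgA.
Qed.
Fact GL_mul1g : left_id GL_one GL_mul.
Proof.
by move=> x; rewrite -(GL_of_repr x) (GL_oneE (tag (repr x))) GL_mulE mul1g.
Qed.
Fact GL_mulg1 : right_id GL_one GL_mul.
Proof.
by move=> x; rewrite -(GL_of_repr x) (GL_oneE (tag (repr x))) GL_mulE mulg1.
Qed.
Fact GL_mulVg : left_inverse GL_one GL_inv GL_mul.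
Proof.
move=> x; rewrite -(GL_of_repr x) (GL_oneE (tag (repr x))).
by rewrite GL_invE GL_mulE mulVg.
Qed.
Fact GL_mulgV : right_inverse GL_one GL_inv GL_mul.
Proof.
move=> x; rewrite -(GL_of_repr x) (GL_oneE (tag (repr x))).
by rewrite GL_invE GL_mulE mulgV.
Qed.

HB.instance Definition _ := isGroup.Build GL
  GL_mulA GL_mul1g GL_mulg1 GL_mulVg GL_mulgV.

Fact GL_of_is_morphism n : {morph @GL_of n : g h / (g * h)%g}.
Proof. by move=> g h; rewrite -GL_mulE. Qed.

HB.instance Definition _ n := isMultiplicative.Build (GLn n) GL (@GL_of n)
  (@GL_of_is_morphism n).

Definition K1 := abelianization GL.

Fact units_GL1_1 (u : units R) : (uval u)%:M * (uinv u)%:M = 1 :> 'M[R]_1.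
Proof. by rewrite -[LHS]scalar_mxM uvalV. Qed.

Fact units_GL1_2 (u : units R) : (uinv u)%:M * (uval u)%:M = 1 :> 'M[R]_1.
Proof. by rewrite -[LHS]scalar_mxM uinvV. Qed.

Definition units_GL1 (u : units R) : GLn 1 :=
  mk_units (units_GL1_1 u) (units_GL1_2 u).

Definition units_K1 (u : units R) : K1 := ab (GL_of (units_GL1 u)).

End StableGL.

(* Main.v *)
Require Import Defs.
From HB Require Import structures.
From mathcomp Require Import all_boot all_order all_algebra.
From mathcomp Require Import boolp.
From Stdlib Require Ncring_tac.

(** The hypothesis enters only through two consequences: every nonzero [x]
    satisfies [a * x * b = 1] for some [a] and [b], and there are [s], [t]
    with [t * s = 1] and [s * t <> 1].  From these one builds [s_i], [t_i],
    for all [i : nat], with [t_i * s_j] equal to [1] if [i = j] and to [0]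
    otherwise: the free module of rank [n] is a summand of the free module of
    rank 1, so an invertible matrix [g] of size [n] acts on that summand and,
    extended by the identity on the complement, becomes the unit
    [1 + S (g - 1) T] of [R], where [S] is the row of the [s_i] and [T] the
    column of the [t_i].  This assignment is multiplicative, and it sends [g]
    and [diag(g, 1)] to the same unit, so it is a homomorphism from GL(R) to
    U(R).  On abelianizations it is inverse to the canonical map:

    - [diag(1 + S (g - 1) T, 1)] is conjugate to [diag(g, 1)] in [GL_{n+1}(R)]
      ([units_K1_unit_of_GLn]), so GL(R) -> U(R) -> K_1(R) is the quotient map;
    - a unit [u] and its image [1 + s_0 (u - 1) t_0] agree modulo commutators.
      Both sides being homomorphisms in [u], it suffices to replace [u] by some
      [v] in the same class.  As in Gaussian elimination, transvections [1 + x]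
      with [x = e x (1 - e)], which are products of commutators
      ([ab_unipotent]), make [v] trivial on a summand that is free of rank 1
      ([ab_fix]).  Then [v] is the identity on that summand plus some [v'] on a
      complement, and likewise [1 + s_0 (v - 1) t_0] is [v'] plus an identity.
      The two identities live on isomorphic summands, because the free module
      of rank 1 absorbs the complement of [s_0 t_0] when a copy of itself is
      split off through [s_0]; hence the two units are conjugate
      ([corner_conj]). *)

Set Implicit Arguments.
Unset Strict Implicit.
Unset Printing Implicit Defensive.

Import GRing.Theory.
Local Open Scope ring_scope.

(** * Normalization of identities in noncommutative rings *)

#[local] Instance nc_ring_ops (R : nzRingType) :
  @Ncring.Ring_ops R 0 1 (fun x y => x + y) (fun x y => x * y)
    (fun x y => x - y) (fun x => - x) eq := {}.

#[local] Instance nc_ring (R : nzRingType) : Ncring.Ring (Ro := nc_ring_ops R).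
Proof.
split; try exact _.
- exact: add0r.
- exact: addrC.
- exact: addrA.
- exact: mul1r.
- exact: mulr1.
- exact: mulrA.
- exact: mulrDl.
- by move=> x y z; apply: mulrDr.
- by [].
- exact: subrr.
Qed.

Ltac nc_ring := Ncring_tac.non_commutative_ring.

(** * Abelianizations *)

Section Abelianization.
Local Open Scope group_scope.

Lemma morph_mulg1 (G H : groupType) (f : G -> H) :
  {morph f : x y / x * y} -> f 1 = 1.
Proof. by move=> fM; apply: (mulgI (f 1)); rewrite -fM !mulg1. Qed.

HB.instance Definition _ (G : groupType) :=
  Multiplicative_isUMagmaMorphism.Build G (abelianization G) (@ab G)
    (morph_mulg1 (@ab_is_morphism G)).

Variable G : groupType.

Lemma abC (x y : G) : ab x * ab y = ab y * ab x.
Proof.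
rewrite -!gmulfM; apply/abP; rewrite invgM.
have -> : y^-1 * x^-1 * (y * x) = [~ y, x] by rewrite /commg /conjg !mulgA.
exact: commutator_subgroup_commg.
Qed.

Lemma ab_eq1_of_swap (x y z : G) : x * y = z * (y * x) -> ab z = 1.
Proof.
move=> /(congr1 (@ab G)); rewrite !gmulfM [ab y * _]abC.
by rewrite -[LHS]mul1g => /mulIg.
Qed.

Lemma ab_conj (x y w : G) : w * x = y * w -> ab x = ab y.
Proof. by move=> /(congr1 (@ab G)); rewrite !gmulfM abC => /mulIg. Qed.

Lemma ab_lift (H : groupType) (f : G -> H) :
  {morph f : x y / x * y} -> (forall x y, f x * f y = f y * f x) ->
  exists phi : {multiplicative abelianization G -> H},
    forall x, phi (ab x) = f x.
Proof.
move=> fM fC.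
have fV x : f x^-1 = (f x)^-1.
  by apply: (mulgI (f x)); rewrite -fM !mulgV morph_mulg1.
pose phi (c : abelianization G) := f (repr c).
have phiE x : phi (ab x) = f x.
  have /abP/asboolP kerP : ab x = ab (repr (ab x)) by rewrite /ab reprK.
  have : x^-1 * repr (ab x) \in [pred z | f z == 1].
    apply: kerP => [|a b]; first split=> [|a b]; rewrite !inE ?morph_mulg1 //.
      by move=> /eqP fa /eqP fb; rewrite fM fV fa fb invg1 mulg1.
    by rewrite /commg /conjg !fM !fV [f a * _]fC mulKg mulVg.
  by rewrite inE fM fV => /eqP/(congr1 (fun z => f x * z)); rewrite mulVKg mulg1.
have phiM : {morph phi : c d / c * d}.
  move=> c d; have [x <-] := ab_surj c; have [y <-] := ab_surj d.
  by rewrite -gmulfM !phiE fM.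
by exists (HB.pack_for {multiplicative abelianization G -> H} phi
  (isMultiplicative.Build _ _ phi phiM)).
Qed.

End Abelianization.

(** * Isometries and full elements of purely infinite simple rings *)

Section PurelyInfinite.
Variable R : nzRingType.

Lemma isometry_defect (s t : R) : t * s = 1 ->
  [/\ (1 - s * t) * (1 - s * t) = 1 - s * t, (1 - s * t) * s = 0
    & t * (1 - s * t) = 0].
Proof.
move=> ts; have tq : t * (1 - s * t) = 0.
  by rewrite mulrBr mulr1 mulrA ts mul1r subrr.
split=> //; first by rewrite {1}mulrBl mul1r -mulrA tq mulr0 subr0.
by rewrite mulrBl mul1r -mulrA ts mulr1 subrr.
Qed.

(** An isomorphism of [eR] with [fR] is left multiplication by some [u] in
    [fRe], with inverse given by some [v] in [eRf]; adding [1 - e] to both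
    turns them into [s] and [t], and then [1 - s t] is the summand [g] of [e]
    complementary to [f].  The last two conditions say that [1 - s t] lies in
    [eR] and that [s] preserves [eR]. *)
Lemma isometry_of_infinite (e : R) : infinite_idempotent e ->
  exists s t : R, [/\ t * s = 1, s * t <> 1, e * (1 - s * t) = 1 - s * t
    & e * (s * e) = s * e].
Proof.
case=> ee [f [g [[ff gg] [fg gf] efg g0 [phi [psi phiK psiK]]]]].
have ef : e * f = f by rewrite efg mulrDl ff gf addr0.
have fe : f * e = f by rewrite efg mulrDr ff fg addr0.
have in_e r : (e * r : R^c^o) \in rprincipal_pred e by apply/asboolP; exists r.
have in_f r : (f * r : R^c^o) \in rprincipal_pred f by apply/asboolP; exists r.
pose E r := RPrincipal (in_e r).
pose u : R := rprincipal_val (phi (E 1)).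
have phiE (x : rprincipal e) :
    rprincipal_val (phi x) = u * rprincipal_val x :> R.
  have {1}-> : x = (rprincipal_val x : R^c) *: E 1.
    apply: val_inj => /=; case: x => x /= /asboolP[r ->].
    by rewrite -[RHS]/(e * 1 * (e * r)) mulr1 mulrA ee.
  by rewrite linearZ.
pose F := RPrincipal (in_f 1).
pose v : R := rprincipal_val (psi F).
have fu : f * u = u.
  by rewrite /u; case: (phi (E 1)) => x /= /asboolP[r ->]; rewrite mulrA ff.
have ev : e * v = v.
  by rewrite /v; case: (psi F) => x /= /asboolP[r ->]; rewrite mulrA ee.
have uv : u * v = f by rewrite -phiE psiK /= mulr1.
have u_inj x y : e * x = x -> e * y = y -> u * x = u * y -> x = y.
  move=> ex ey uxy; have : phi (E x) = phi (E y).
    by apply: val_inj; rewrite /= !phiE /= ex ey.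
  by move=> /(can_inj phiK)/(congr1 (@rprincipal_val R e)) /=; rewrite ex ey.
have ue : u * e = u by have := phiE (E 1); rewrite /= mulr1.
have vu : v * u = e by apply: u_inj; rewrite ?mulrA ?ev ?ee // uv fu ue.
have vf : v * f = v by apply: u_inj; rewrite ?mulrA ?ev // uv ff.
have ve : v * e = v by rewrite -vf -mulrA fe.
have eu : e * u = u by rewrite -fu mulrA ef.
have stE : 1 - (1 - e + u) * (1 - e + v) = g.
  have -> : 1 - (1 - e + u) * (1 - e + v)
    = e + e - e * e - u + u * e - v + e * v - u * v by nc_ring.
  rewrite ee ue ev uv efg; nc_ring.
exists (1 - e + u), (1 - e + v); split.
- have -> : (1 - e + v) * (1 - e + u)
    = 1 - e - e + e * e + u - e * u + v - v * e + v * u by nc_ring.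
  rewrite ee eu ve vu; nc_ring.
- by move=> st1; apply: g0; rewrite -stE st1 subrr.
- by rewrite stE efg mulrDl fg gg add0r.
- have -> : (1 - e + u) * e = e - e * e + u * e by nc_ring.
  by rewrite ee ue subrr add0r eu.
Qed.

(** By simplicity [1 = \sum_i a_i g b_i] with [g = 1 - s t].  The elements
    [s^i g] and [g t^i] are biorthogonal, so the sum collapses to the single
    product [(\sum_i a_i g t^i) * (\sum_i s^i g b_i)], whose second factor
    lies in [eR].  The ideal [I] below consists of the elements with such a
    factorization; the second factor being killed by a power of [t] is what
    lets two factorizations be merged after shifting one of them. *)
Lemma infinite_idempotent_full (e : R) :
  simple_ring R -> infinite_idempotent e -> exists a b, a * e * b = 1.
Proof.
move=> simpleR inf_e; have [s [t [ts st1 eg es]]] := isometry_of_infinite inf_e.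
have tsn n : t ^+ n * s ^+ n = 1.
  elim: n => [|n IHn]; first by rewrite !expr0 mulr1.
  by rewrite exprSr exprS mulrA -[_ * t * s]mulrA ts mulr1 IHn.
have esn n x : e * x = x -> e * (s ^+ n * x) = s ^+ n * x.
  move=> ex; elim: n => [|n IHn]; first by rewrite expr0 mul1r.
  by rewrite exprS -mulrA -IHn !mulrA -[e * s * e]mulrA es.
pose I : {pred R} := fun x =>
  `[< exists n A B, [/\ x = A * B, e * B = B & t ^+ n * B = 0] >].
have idealI : two_sided_ideal I.
  split; first split.
  - by apply/asboolP; exists 0, 0, 0; rewrite !mulr0.
  - move=> _ _ /asboolP[n [A [B [-> eB tB]]]] /asboolP[m [C [D [-> eD tD]]]].
    (* [s ^+ n] moves [D] out of the way of [B]: the left factor of the sum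
       equals [A] on [B] and [- C * t ^+ n] on [s ^+ n * D]. *)
    apply/asboolP; exists (m + n)%N, (A * (1 - s ^+ n * t ^+ n) - C * t ^+ n).
    exists (B + s ^+ n * D); split.
    + have -> : (A * (1 - s ^+ n * t ^+ n) - C * t ^+ n) * (B + s ^+ n * D)
        = A * B - A * s ^+ n * (t ^+ n * B) + A * s ^+ n * D
          - A * s ^+ n * (t ^+ n * s ^+ n) * D
          - C * (t ^+ n * B) - C * (t ^+ n * s ^+ n) * D by nc_ring.
      rewrite tB tsn; nc_ring.
    + by rewrite mulrDr eB esn.
    + by rewrite exprD -mulrA mulrDr tB add0r (mulrA (t ^+ n)) tsn mul1r.
  - move=> _ r /asboolP[n [A [B [-> eB tB]]]]; split; apply/asboolP.
      by exists n, (r * A), B; rewrite mulrA.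
    by exists n, A, (B * r); rewrite !mulrA eB tB mul0r.
have Ig : 1 - s * t \in I.
  apply/asboolP; exists 1%N, 1, (1 - s * t); rewrite mul1r; split=> //.
  by rewrite expr1 mulrBr mulr1 mulrA ts mul1r subrr.
have [I0|IR] := simpleR I idealI.
  by case: st1; apply/esym/subr0_eq/I0.
by have /asboolP[n [A [B [AB eB _]]]] := IR 1; exists A, B; rewrite -mulrA eB.
Qed.

Definition all_nonzero_full :=
  forall x : R, x <> 0 -> exists a b, a * x * b = 1.

Lemma purely_infinite_full : purely_infinite_simple R -> all_nonzero_full.
Proof.
move=> [simpleR infR] x x0.
have [||e /asboolP[r ->] /(infinite_idempotent_full simpleR)[a [b ab1]]] :=
    infR (fun y => `[< exists r, y = x * r >]).
- split=> [|y r /asboolP[z ->]]; last by apply/asboolP; exists (z * r); rewrite mulrA.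
  split=> [|_ _ /asboolP[y ->] /asboolP[z ->]]; apply/asboolP.
    by exists 0; rewrite mulr0.
  by exists (y - z); rewrite mulrBr.
- by exists x => //; apply/asboolP; exists 1; rewrite mulr1.
by exists a, (r * b); rewrite !mulrA in ab1 *.
Qed.

Lemma purely_infinite_isometry : purely_infinite_simple R ->
  exists s t : R, t * s = 1 /\ s * t <> 1.
Proof.
move=> [_ infR].
have [||e _ /isometry_of_infinite[s [t [ts st1 _ _]]]] := infR predT.
- by [].
- by exists 1 => //; apply/eqP/oner_neq0.
by exists s, t.
Qed.

(** The defect [q = 1 - s t] is full, say [a q b = 1], and its translates
    [s^i q t^i] are orthogonal, which gives infinitely many orthogonal copies
    of the identity. *)
Lemma isometry_family : purely_infinite_simple R ->
  exists s t : nat -> R, forall i j, t i * s j = (i == j)%:R.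
Proof.
move=> piR; have [s [t [ts st1]]] := purely_infinite_isometry piR.
have [a [b aqb]] : exists a b, a * (1 - s * t) * b = 1.
  by apply: (purely_infinite_full piR) => /subr0_eq/esym.
pose q := 1 - s * t.
have [qq qs tq] := isometry_defect ts.
rewrite -/q in qq qs tq.
have qsn n : q * s ^+ n.+1 = 0 by rewrite exprS mulrA qs mul0r.
have tnq n : t ^+ n.+1 * q = 0 by rewrite exprSr -mulrA tq mulr0.
exists (fun i => s ^+ i * q * b), (fun i => a * q * t ^+ i) => i j.
elim: i j => [|i IHi] [|j].
- by rewrite !expr0 mulr1 mul1r -(mulrA a) (mulrA q) qq mulrA.
- by rewrite expr0 mulr1 -(mulrA a) !(mulrA q) qsn !mul0r mulr0.
- by rewrite expr0 mul1r (mulrA _ q b) -(mulrA _ (t ^+ _)) tnq mulr0 mul0r.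
rewrite exprSr exprS eqSS -IHi !mulrA; congr (_ * _ * _).
by rewrite -(mulrA _ t s) ts mulr1.
Qed.

(** * Transvections are products of commutators *)

Definition square_zero_unit (x : R) (xx : x * x = 0) : units R.
Proof.
apply: (@mk_units _ (1 + x) (1 - x)).
  by rewrite mulrDl mul1r mulrBr mulr1 xx subr0 subrK.
by rewrite mulrBl mul1r mulrDr mulr1 xx addr0 addrK.
Defined.

Lemma square_zero_unitE (x : R) (xx : x * x = 0) :
  uval (square_zero_unit xx) = 1 + x.
Proof. by []. Qed.

(** The commutator of [1 + p] and [1 + q] is [1 + p q], since [q p = 0]. *)
Lemma ab_unipotent_mul (p q : R) (z : units R) :
  p * p = 0 -> q * q = 0 -> q * p = 0 -> uval z = 1 + p * q -> ab z = 1%g.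
Proof.
move=> pp qq qp zE; apply: (@ab_eq1_of_swap _ (square_zero_unit pp) (square_zero_unit qq)).
apply: uval_inj; rewrite !uvalM !square_zero_unitE zE.
have -> : (1 + p * q) * ((1 + q) * (1 + p)) = (1 + p) * (1 + q)
    + p * q * q + q * p + p * (q * p) + p * q * (q * p) by nc_ring.
by rewrite qp -(mulrA p) qq !mulr0 !addr0.
Qed.

Section FullRing.
Hypothesis full : all_nonzero_full.

(** A third idempotent [g], orthogonal to the support of [x], leaves room for
    the commutator formula of elementary matrices: fullness of [g] factors [x]
    as a map into [g] followed by a map out of it. *)
Lemma ab_unipotent_room (f g x : R) (z : units R) :
  x * f = x -> f * x = 0 -> g * g = g -> f * g = 0 -> g * x = 0 -> g <> 0 ->
  uval z = 1 + x -> ab z = 1%g.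
Proof.
move=> xf fx gg fg gx /full[a [b agb]] zE.
apply: (@ab_unipotent_mul (x * a * g) (g * b * f)).
- by rewrite -!mulrA (mulrA g x) gx !(mul0r, mulr0).
- by rewrite -!mulrA (mulrA f g) fg !(mul0r, mulr0).
- by rewrite -!mulrA (mulrA f x) fx !(mul0r, mulr0).
rewrite zE; have -> : x * a * g * (g * b * f) = x * (a * (g * g) * b) * f.
  by rewrite !mulrA.
by rewrite gg agb mulr1 xf.
Qed.

Variables s t : R.
Hypothesis ts : t * s = 1.
Hypothesis st1 : s * t <> 1.

(** The idempotents [e] and [1 - e] leave no room, but [e] is itself the sum
    [e1 + e2] of two nonzero orthogonal idempotents.  Then
    [1 + x = (1 + e1 x) (1 + e2 x)], where each factor leaves the other
    summand free. *)
Lemma ab_unipotent (e x : R) (z : units R) :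
  e * e = e -> e * x = x -> x * e = 0 -> uval z = 1 + x -> ab z = 1%g.
Proof.
move=> ee ex xe zE; have [x0|/eqP x0] := pselect (x = 0).
  have -> : z = 1%g by apply: uval_inj; rewrite zE x0 addr0.
  exact: gmulf1.
have [a [b aeb]] : exists a b, a * e * b = 1.
  by apply: full => e0; case/eqP: x0; rewrite -ex e0 mul0r.
(* [e * b] and [a * e] transport [s * t], a proper idempotent of [R], into
   the corner [e R e]. *)
pose e1 := e * b * s * t * a * e; pose e2 := e - e1.
have ee1 : e * e1 = e1 by rewrite /e1 !mulrA ee.
have e1e : e1 * e = e1 by rewrite /e1 -!mulrA ee.
have e11 : e1 * e1 = e1.
  have -> : e1 * e1 = e * b * s * t * (a * (e * e) * b) * s * t * a * e.
    by rewrite /e1 !mulrA.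
  by rewrite ee aeb mulr1 -(mulrA _ t s) ts mulr1.
have ne1 : e1 <> 0.
  move=> e10; have : t * (a * e * b) * s * t * (a * e * b) * s = 0.
    have <- : t * a * e1 * b * s = t * (a * e * b) * s * t * (a * e * b) * s.
      by rewrite /e1 !mulrA.
    by rewrite e10 !(mulr0, mul0r).
  by rewrite aeb !mulr1 ts mul1r ts => /eqP; rewrite oner_eq0.
have ne2 : e2 <> 0.
  move/subr0_eq => e1E; apply: st1.
  have : a * e * b = a * e1 * b by rewrite -e1E.
  have -> : a * e1 * b = (a * e * b) * s * t * (a * e * b) by rewrite /e1 !mulrA.
  by rewrite aeb mul1r mulr1 => ->.
have e12 : e1 * e2 = 0 by rewrite /e2 mulrBr e1e e11 subrr.
have e21 : e2 * e1 = 0 by rewrite /e2 mulrBl ee1 e11 subrr.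
have e22 : e2 * e2 = e2 by rewrite {1}/e2 mulrBl e12 /e2 mulrBr ee ee1 subr0.
have ee2 : e * e2 = e2 by rewrite /e2 mulrBr ee ee1.
have xei ei : e * ei = ei -> x * ei = 0 by move=> <-; rewrite mulrA xe mul0r.
have sq ei : e * ei = ei -> ei * x * (ei * x) = 0.
  by move=> eei; rewrite -mulrA (mulrA x) xei // mul0r mulr0.
have room ei ej (eei : e * ei = ei) : ei * ej = 0 -> ej * ej = ej -> ej * ei = 0 ->
    ei * e = ei -> e * ej = ej -> ej <> 0 ->
    ab (square_zero_unit (sq ei eei)) = 1%g.
  move=> ij jj ji eie eej nj; apply: (@ab_unipotent_room (1 - e) ej (ei * x)) => //.
  - by rewrite mulrBr mulr1 -mulrA xe mulr0 subr0.
  - by rewrite mulrBl mul1r mulrA eei subrr.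
  - by rewrite mulrBl mul1r eej subrr.
  - by rewrite mulrA ji mul0r.
have -> : z = (square_zero_unit (sq e1 ee1) * square_zero_unit (sq e2 ee2))%g.
  apply: uval_inj; rewrite zE uvalM !square_zero_unitE.
  have -> : (1 + e1 * x) * (1 + e2 * x) = 1 + e * x + e1 * (x * e2) * x.
    rewrite /e2; nc_ring.
  by rewrite ex xei // mulr0 mul0r addr0.
have e2e : e2 * e = e2 by rewrite /e2 mulrBl ee e1e.
by rewrite gmulfM /= (room e1 e2 ee1) // (room e2 e1 ee2) // mulg1.
Qed.

(** * Units that are trivial on a free summand *)

Lemma unipotent_mul (e x : R) (u : units R) :
  e * e = e -> e * x = x -> x * e = 0 ->
  exists2 v : units R, ab v = ab u & uval v = (1 + x) * uval u.
Proof.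
move=> ee ex xe; have xx : x * x = 0 by rewrite -{2}ex mulrA xe mul0r.
exists (square_zero_unit xx * u)%g => //.
by rewrite gmulfM /= (ab_unipotent ee ex xe (square_zero_unitE xx)) mul1g.
Qed.

Lemma mul_unipotent (e x : R) (u : units R) :
  e * e = e -> e * x = x -> x * e = 0 ->
  exists2 v : units R, ab v = ab u & uval v = uval u * (1 + x).
Proof.
move=> ee ex xe; have xx : x * x = 0 by rewrite -{2}ex mulrA xe mul0r.
exists (u * square_zero_unit xx)%g => //.
by rewrite gmulfM /= (ab_unipotent ee ex xe (square_zero_unitE xx)) mulg1.
Qed.

(** Gaussian elimination with respect to the idempotent [b a].  The column of
    [u] through [b] has an invertible part seen by [c], off the diagonal since
    [c b = 0]; it is used to make the diagonal entry equal to [1] ([u1]), then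
    the rest of the column ([u2]) and the rest of the row ([u3]) are
    cleared. *)
Lemma fix_of_column (b c : R) (u : units R) :
  c * b = 0 -> c * uval u * b = 1 ->
  exists (v : units R) (a : R),
    [/\ ab v = ab u, a * b = 1, uval v * b = b & a * uval v = a].
Proof.
move=> cb cub; have [a aE] : exists a, a = c * uval u by exists (c * uval u).
have ab1 : a * b = 1 by rewrite aE.
have bab : b * a * b = b by rewrite -mulrA ab1 mulr1.
have bab2 : b * a * (b * a) = b * a by rewrite mulrA bab.
have [||| u1 u1u u1E] := @unipotent_mul (b * a) (b * (1 - a * uval u * b) * c) u.
- by [].
- by rewrite !mulrA bab.
- by rewrite mulrA -[_ * c * b]mulrA cb mulr0 mul0r.
have u1b : a * uval u1 * b = 1.
  have -> : a * uval u1 * b =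
      a * uval u * b + (a * b) * (1 - a * uval u * b) * (c * uval u * b).
    rewrite u1E; nc_ring.
  by rewrite ab1 cub mulr1 mul1r addrC subrK.
have [||| u2 u2u u2E] := @unipotent_mul (1 - b * a) ((b - uval u1 * b) * a) u1.
- by rewrite mulrBl mul1r mulrBr mulr1 bab2 subrr subr0.
- have -> : (1 - b * a) * ((b - uval u1 * b) * a) =
      (b - uval u1 * b - b * (a * b) + b * (a * uval u1 * b)) * a by nc_ring.
  by rewrite ab1 u1b mulr1 subrK.
- have -> : (b - uval u1 * b) * a * (1 - b * a) =
      (b - uval u1 * b) * (1 - a * b) * a by nc_ring.
  by rewrite ab1 subrr mulr0 mul0r.
have u2b : uval u2 * b = b.
  have -> : uval u2 * b = uval u1 * b + (b - uval u1 * b) * (a * uval u1 * b).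
    rewrite u2E; nc_ring.
  by rewrite u1b mulr1 addrC subrK.
have [||| u3 u3u u3E] := @mul_unipotent (b * a) (b * (a - a * uval u2)) u2.
- by [].
- by rewrite mulrA bab.
- by rewrite mulrA -[_ * _ * b]mulrA mulrBl -(mulrA a) u2b subrr mulr0 mul0r.
exists u3, a; split=> //; first by rewrite u3u u2u.
  have -> : uval u3 * b = uval u2 * b + uval u2 * b * (a * b - a * (uval u2 * b)).
    rewrite u3E; nc_ring.
  by rewrite u2b subrr mulr0 addr0.
have -> : a * uval u3 = a * uval u2 + a * (uval u2 * b) * (a - a * uval u2).
  rewrite u3E; nc_ring.
by rewrite u2b ab1 mul1r addrC subrK.
Qed.

(** Some nonzero entry of [u] off the diagonal of the decomposition
    [1 = e + f] is needed; if the entry [f u e] vanishes, a transvection adds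
    a multiple of the nonzero element [e u e] to it.  Fullness of that entry
    provides [b] and [c] as in [fix_of_column]. *)
Lemma ab_fix (u : units R) : exists (v : units R) (a b : R),
  [/\ ab v = ab u, a * b = 1, uval v * b = b & a * uval v = a].
Proof.
have [e eE] : exists e, e = s * t by exists (s * t).
pose f := 1 - e.
have ee : e * e = e by rewrite eE mulrA -(mulrA s) ts mulr1.
have fe : f * e = 0 by rewrite mulrBl mul1r ee subrr.
have ef : e * f = 0 by rewrite mulrBr mulr1 ee subrr.
have ff : f * f = f by rewrite {2}/f mulrBr mulr1 fe subr0.
have [w wu wfe] : exists2 w : units R, ab w = ab u & f * uval w * e <> 0.
  have [fue|] := pselect (f * uval u * e = 0); last by exists u.
  have ue0 : uval u * e <> 0.
    move=> ue0; have e0 : e = 0 by rewrite -[e]mul1r -(uinvV u) -mulrA ue0 mulr0.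
    have : t * e * s = 1 by rewrite eE mulrA ts mul1r ts.
    by rewrite e0 mulr0 mul0r => /eqP; rewrite eq_sym oner_eq0.
  have [a [b aueb]] := full ue0.
  have eue : e * uval u * e = uval u * e.
    by move: fue; rewrite mulrBl mul1r mulrBl => /subr0_eq.
  have [|||w wu wE] := @unipotent_mul f (f * a * e) u.
  - by [].
  - by rewrite !mulrA ff.
  - by rewrite -(mulrA _ e) ef mulr0.
  exists w => // fwe; apply: st1; apply/esym/subr0_eq.
  rewrite -eE -/f -[f]mulr1 -aueb -[LHS]/(f * (a * (uval u * e) * b)) -eue.
  have -> : f * (a * (e * uval u * e) * b) =
      ((f * uval w * e) - f * uval u * e + (f - f * f) * a * e * uval u * e) * b.
    rewrite wE; nc_ring.
  by rewrite fwe fue ff !subrr !mul0r addr0 mul0r.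
have [a [b afweb]] := full wfe.
have [||v [c [vw cb vb cv]]] := @fix_of_column (e * b) (a * f) w.
- by rewrite mulrA -(mulrA a) fe mulr0 mul0r.
- by rewrite -afweb !mulrA.
by exists v, c, (e * b); rewrite vw.
Qed.

End FullRing.

(** * A unit and its copy in a corner *)

Section Corner.
Variables s t : R.
Hypothesis ts : t * s = 1.

(** Equal to [s x t + (1 - s t)]: the copy of [x] in the corner of [s t],
    extended by the identity. *)
Definition corner_unit_val (x : R) := 1 + s * (x - 1) * t.

(** With [e = b a] and [q = 1 - s t], the element [u] is the identity on [e]
    and [corner_unit_val u] is the identity on [q + s e t], the rest of the
    two being matched by [(1 - e) t].  Multiplication by [q + s a t] identifies
    [q + s e t] with [1], and multiplication by [b] identifies [1] with [e]. *)
Lemma corner_conj (u : R) (a b : R) : a * b = 1 -> u * b = b -> a * u = a ->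
  exists w : units R, uval w * corner_unit_val u = u * uval w.
Proof.
move=> ab1 ub au; pose e := b * a; pose q := 1 - s * t.
have [qq qs tq] := isometry_defect ts.
rewrite -/q in qq qs tq.
have eb : (1 - e) * b = 0 by rewrite mulrBl mul1r -mulrA ab1 mulr1 subrr.
have ae : a * (1 - e) = 0 by rewrite mulrBr mulr1 mulrA ab1 mul1r subrr.
pose w := (1 - e) * t + b * (q + s * a * t).
pose w' := s * (1 - e) + (q + s * b * t) * a.
have ww' : w * w' = 1.
  have -> : w * w' = (1 - e) * (t * s) * (1 - e) + (1 - e) * (t * q) * a
      + (1 - e) * (t * s) * b * t * a + b * (q * s) * (1 - e)
      + b * s * a * (t * s) * (1 - e) + b * (q * q) * a + b * (q * s) * b * t * a
      + b * s * a * (t * q) * a + b * s * a * (t * s) * b * t * a.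
    rewrite /w /w'; nc_ring.
  rewrite ts tq qs qq !(mulr0, mul0r, mulr1) eb -(mulrA (b * s) a (1 - e)) ae.
  have -> : (1 - e) * (1 - e) = 1 - e - (1 - e) * b * a by rewrite /e; nc_ring.
  rewrite -(mulrA _ a b) ab1 eb /e /q; nc_ring.
have w'w : w' * w = 1.
  have -> : w' * w = s * (1 - e) * t - s * ((1 - e) * b) * a * t
     + s * ((1 - e) * b) * (q + s * a * t) + (q + s * b * t) * (a * (1 - e)) * t
     + (q + s * b * t) * (a * b) * (q + s * a * t).
    rewrite /w /w' /e; nc_ring.
  rewrite eb ae ab1 !(mulr0, mul0r, mulr1).
  have -> : (q + s * b * t) * (q + s * a * t) = q * q + q * s * a * t
    + s * b * (t * q) + s * b * (t * s) * a * t by nc_ring.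
  rewrite qq qs tq ts /q /e; nc_ring.
exists (mk_units ww' w'w); rewrite -[uval _]/w.
have -> : w * corner_unit_val u = w + (1 - e) * (t * s) * (u - 1) * t
    + b * (q * s) * (u - 1) * t + b * s * a * (t * s) * (u - 1) * t.
  rewrite /w /corner_unit_val; nc_ring.
rewrite ts qs /w.
have -> : (1 - e) * 1 * (u - 1) * t = (u - 1) * t - b * (a * u - a) * t.
  rewrite /e; nc_ring.
have -> : b * s * a * 1 * (u - 1) * t = b * s * (a * u - a) * t by nc_ring.
have -> : u * ((1 - e) * t + b * (q + s * a * t)) = (1 - e) * t
    + b * (q + s * a * t) + (u - 1) * t + (u * b - b) * (q + s * a * t)
    - (u * b - b) * a * t by rewrite /e; nc_ring.
rewrite au ub; nc_ring.
Qed.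
End Corner.

(** * From invertible matrices to units *)

Section UnitOfGL.
Variables s t : nat -> R.
Hypothesis ts : forall i j, t i * s j = (i == j)%:R.

Definition isometry_row n : 'M[R]_(1, n) := \row_i s i.
Definition isometry_col n : 'M[R]_(n, 1) := \col_i t i.

Lemma isometry_col_row n : isometry_col n *m isometry_row n = 1%:M.
Proof. by apply/matrixP=> i j; rewrite !mxE big_ord1 !mxE ts. Qed.

(** The matrix [A] acting on the summand of [R] cut out by the idempotent
    [\sum_i s_i t_i], extended by the identity on the complement.  Written with
    [A - 1] it visibly does not change when [A] becomes [diag(A, 1)]. *)
Definition corner_mx n (A : 'M[R]_n) : 'M[R]_1 :=
  1%:M + isometry_row n *m (A - 1%:M) *m isometry_col n.

Lemma corner_mx1 n : corner_mx (1%:M : 'M_n) = 1%:M.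
Proof. by rewrite /corner_mx subrr mulmx0 mul0mx addr0. Qed.

Lemma corner_mxM n (A B : 'M[R]_n) :
  corner_mx (A *m B) = corner_mx A *m corner_mx B.
Proof.
rewrite -(subrK 1%:M A) -(subrK 1%:M B) /corner_mx !addrK.
move: (A - 1%:M) (B - 1%:M) => X Y.
have -> : (X + 1%:M) *m (Y + 1%:M) - 1%:M = X *m Y + X + Y.
  by rewrite mulmxDl mulmxDr mulmx1 mul1mx addrA addrK.
have tsK p (Z : 'M_(n, p)) : isometry_col n *m (isometry_row n *m Z) = Z.
  by rewrite mulmxA isometry_col_row mul1mx.
rewrite !(mulmxDl, mulmxDr) mulmx1 mul1mx -!mulmxA tsK mulmx1 -[RHS]addrA.
by congr (_ + _); rewrite addrC; congr (_ + _); apply: addrC.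
Qed.

Lemma corner_mx_stab N n (nN : (n <= N)%N) (A : 'M[R]_n) :
  corner_mx (stab_mx N A) = corner_mx A.
Proof.
rewrite -(subnKC nN) stab_mx_block /corner_mx; set k := (N - n)%N; congr (_ + _).
have -> : isometry_row (n + k) = row_mx (isometry_row n) (\row_i s (n + i)).
  apply/matrixP=> i j; rewrite mxE; rewrite -(splitK j).
  by case: (split j) => j' /=; rewrite ?row_mxEl ?row_mxEr mxE.
have -> : isometry_col (n + k) = col_mx (isometry_col n) (\col_i t (n + i)).
  apply/matrixP=> i j; rewrite mxE; rewrite -(splitK i).
  by case: (split i) => i' /=; rewrite ?col_mxEu ?col_mxEd mxE.
rewrite (scalar_mx_block n k 1) opp_block_mx add_block_mx oppr0 !addr0 subrr.
by rewrite mul_row_block mul_row_col !subrr !mulmx0 !addr0 mul0mx addr0.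
Qed.

Lemma corner_mx_entryM n (A B : 'M[R]_n) : A *m B = 1%:M ->
  corner_mx A 0 0 * corner_mx B 0 0 = 1.
Proof.
move=> AB; transitivity ((corner_mx A *m corner_mx B) 0 0).
  by rewrite [RHS]mxE big_ord1.
by rewrite -corner_mxM AB corner_mx1 mxE.
Qed.

Definition unit_of_GLn n (g : GLn R n) : units R :=
  mk_units (corner_mx_entryM (uvalV g)) (corner_mx_entryM (uinvV g)).

Lemma unit_of_GLnE n (g : GLn R n) :
  (uval (unit_of_GLn g))%:M = corner_mx (uval g).
Proof. exact: esym (mx11_scalar (corner_mx (uval g))). Qed.

Lemma unit_of_GLnM n (g h : GLn R n) :
  unit_of_GLn (g * h)%g = (unit_of_GLn g * unit_of_GLn h)%g.
Proof.
apply: uval_inj; rewrite uvalM -[LHS]/(corner_mx (uval g *m uval h) 0 0).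
by rewrite corner_mxM mxE big_ord1.
Qed.

Lemma unit_of_GLn_stab N n (nN : (n <= N)%N) (g : GLn R n) :
  unit_of_GLn (stab_GLn nN g) = unit_of_GLn g.
Proof. by apply: uval_inj; rewrite -[LHS]/(corner_mx _ 0 0) corner_mx_stab. Qed.

Lemma unit_of_GLn_eq n m (g : GLn R n) (h : GLn R m) :
  GL_of g = GL_of h -> unit_of_GLn g = unit_of_GLn h.
Proof.
move=> gh; rewrite -(unit_of_GLn_stab (leq_maxl n m)).
rewrite -(unit_of_GLn_stab (leq_maxr n m) h).
by congr unit_of_GLn; apply: GL_of_inj; rewrite !GL_of_stab.
Qed.

Lemma unit_of_GL1 (u : units R) :
  uval (unit_of_GLn (units_GL1 u)) = corner_unit_val (s 0) (t 0) (uval u).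
Proof.
rewrite -[LHS]/(corner_mx (uval u)%:M 0 0) /corner_mx /corner_unit_val.
have -> : isometry_row 1 = (s 0)%:M.
  by apply/matrixP=> i j; rewrite !ord1 !mxE eqxx.
have -> : isometry_col 1 = (t 0)%:M.
  by apply/matrixP=> i j; rewrite !ord1 !mxE eqxx.
by rewrite -raddfB -!scalar_mxM -raddfD mxE eqxx.
Qed.

Definition unit_of_GL (x : GL R) : units R := unit_of_GLn (tagged (repr x)).

Lemma unit_of_GLE n (g : GLn R n) : unit_of_GL (GL_of g) = unit_of_GLn g.
Proof. by apply: unit_of_GLn_eq; rewrite GL_of_repr. Qed.

Lemma unit_of_GLM : {morph unit_of_GL : x y / (x * y)%g}.
Proof.
move=> x y; have [[n xn] [m ym]] := (GL_of_large x, GL_of_large y).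
have [g <-] := xn _ (leq_maxl n m); have [h <-] := ym _ (leq_maxr n m).
by rewrite -gmulfM !unit_of_GLE unit_of_GLnM.
Qed.

(** The sizes [p] and [q] are kept apart because the conjugating matrices are
    blocks of shape [n + 1] by [1 + n]. *)
Lemma ab_GL_conj p q (pq : p = q) (g : GLn R p) (h : GLn R q)
    (P : 'M_(p, q)) (Q : 'M_(q, p)) :
  P *m Q = 1%:M -> Q *m P = 1%:M -> uval h *m Q = Q *m uval g ->
  ab (GL_of g) = ab (GL_of h).
Proof.
case: q / pq h P Q => h P Q PQ QP hQ.
apply: (@ab_conj _ _ _ (GL_of (@mk_units 'M[R]_p Q P QP PQ))).
by rewrite -!gmulfM; congr GL_of; apply: uval_inj; rewrite !uvalM.
Qed.

(** With [S] the row of the [s_i] and [T] the column of the [t_i], the relation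
    [T S = 1] makes the free module of rank 1 the sum of the free module of
    rank [n] and the image of [1 - S T].  Exchanging these pieces gives the
    conjugation [Q] from [diag(g, 1)] to [diag(1 + S (g - 1) T, 1)]. *)
Lemma units_K1_unit_of_GLn n (g : GLn R n) :
  units_K1 (unit_of_GLn g) = ab (GL_of g).
Proof.
have n1 : (n <= n + 1)%N by rewrite leq_addr.
have n2 : (1 <= 1 + n)%N by rewrite leq_addr.
rewrite /units_K1 -(GL_of_stab n1) -(GL_of_stab n2).
set S := isometry_row n; set T := isometry_col n; have TS := isometry_col_row n.
pose Q := block_mx S (1%:M - S *m T) 0 T.
pose P := block_mx T 0 (1%:M - S *m T) S.
have eS : (1%:M - S *m T) *m S = 0.
  by rewrite mulmxBl mul1mx -mulmxA TS mulmx1 subrr.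
have Te : T *m (1%:M - S *m T) = 0.
  by rewrite mulmxBr mulmx1 mulmxA TS mul1mx subrr.
have ee : (1%:M - S *m T) *m (1%:M - S *m T) = 1%:M - S *m T.
  by rewrite {1}mulmxBl mul1mx -mulmxA Te mulmx0 subr0.
symmetry; apply: (@ab_GL_conj _ _ (addnC n 1) _ _ P Q).
- rewrite mulmx_block TS Te eS ee !mulmx0 !mul0mx !addr0.
  by rewrite subrK -scalar_mx_block.
- rewrite mulmx_block TS Te eS ee !mulmx0 !mul0mx !addr0 add0r.
  by rewrite addrC subrK -scalar_mx_block.
rewrite -[uval _]/(stab_mx _ _) -[X in _ = _ *m X]/(stab_mx _ _) !stab_mx_block.
rewrite -[uval (units_GL1 _)]/(_%:M) unit_of_GLnE.
rewrite !mulmx_block !mulmx0 !mul0mx !mulmx1 !mul1mx !addr0 !add0r.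
rewrite /corner_mx -/S -/T.
congr block_mx.
  by rewrite mulmxDl mul1mx -(mulmxA _ T) TS mulmx1 mulmxBr mulmx1 addrC subrK.
by rewrite mulmxDl mul1mx -(mulmxA _ T) Te mulmx0 addr0.
Qed.

End UnitOfGL.

End PurelyInfinite.

(** * The isomorphism *)

Theorem theorem2p4 (R : nzRingType) (hR : purely_infinite_simple R) :
  exists phi : {multiplicative abelianization (units R) -> K1 R},
    (forall u : units R, phi (ab u) = units_K1 u) /\ bijective phi.
Proof.
have full := purely_infinite_full hR.
have [s0 [t0 [ts0 st0]]] := purely_infinite_isometry hR.
have [s [t ts]] := isometry_family hR.
have [||phi phiE] := @ab_lift _ (K1 R) (@units_K1 R).
- move=> u v; rewrite /units_K1 -!gmulfM; congr (ab (GL_of _)).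
  by apply: uval_inj; rewrite uvalM -[RHS]scalar_mxM.
- by move=> u v; apply: abC.
have [||psi psiE] := @ab_lift _ _ (fun x => ab (unit_of_GL ts x)).
- by move=> x y; rewrite unit_of_GLM gmulfM.
- by move=> x y; apply: abC.
exists phi; split=> //; exists psi => c.
  have [u <-] := ab_surj c.
  have [v [a [b [<- ab1 vb av]]]] := ab_fix full ts0 st0 u.
  have [w wE] := corner_conj (ts 0 0) ab1 vb av.
  rewrite phiE psiE unit_of_GLE; apply: (ab_conj (w := w)).
  by apply: uval_inj; rewrite !uvalM unit_of_GL1.
have [x <-] := ab_surj c; rewrite psiE phiE -(GL_of_repr x) unit_of_GLE.
exact: units_K1_unit_of_GLn.
Qed.
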